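(* Let $A_1$, $A_2$, and $J$ be three finite sets, each of which contains at least two elements. Let $\sigma_1$ (resp. $\sigma_2$) be a stationary strategy for coordinate $1$ (resp. $2$) that selects all elements in $A_1$ (resp. $A_2$) with positive probability, and let $\nu$ be any probability distribution on $J$. There is a mechanism $M = (\tau,J,f)$ that, together with the pair of strategies $(\sigma_1,\sigma_2)$, $0$-implements $\nu$ in a weak secure fashion.
   Context: Let $A_1,A_2$ be finite sets, each containing at least two elements. The set of finite histories is $H := \bigcup_{t=0}^\infty (A_1 \times A_2)^t$ (where $(A_1\times A_2)^0$ contains only the empty history), and the set of infinite histories is $H^\infty := (A_1 \times A_2)^\infty$, equipped with the product $\sigma$-algebra. For $t \ge 0$, $\mathcal{F}^t$ is the $\sigma$-algebra on $H^\infty$ generated by the first $t$ entries $(a^1,\dots,a^t)$ of the infinite history $(a^1,a^2,\dots)$. A mechanism is a triplet $M=(\tau,J,f)$ where $\tau$ is a stopping time (possibly taking the value $\infty$) with respect to the filtration $(\mathcal{F}^t)_{t\ge 0}$, $J$ is a finite set, and $f: H^\infty \to J$ is a function that is measurable with respect to the $\sigma$-algebra $\mathcal{F}^\tau$. Every probability distribution $\mu$ over $H^\infty$ defines a probability distribution $\mu_M$ over $J$ by $\mu_M(j) = \mu(\{h \in H^\infty : f(h)=j\})$. For $i\in\{1,2\}$, a (behavior) strategy for coordinate $i$ is a function $\sigma_i : H \to \Delta(A_i)$, where $\Delta(A_i)$ is the set of probability distributions on $A_i$; $\Sigma_i$ is the set of all such strategies. A strategy is stationary if $\sigma_i(h)$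 does not depend on $h\in H$. A pair $(\sigma_1,\sigma_2)$ induces a probability measure $\mathbf{P}_{\sigma_1,\sigma_2}$ on $H^\infty$ (after each finite history the two coordinates choose the next letters independently according to $\sigma_1$ and $\sigma_2$). Together with a mechanism $M$ it defines the probability measure $\mathbf{P}_{\sigma_1,\sigma_2,M}$ over $J$ given by $\mathbf{P}_{\sigma_1,\sigma_2,M}(j) = \mathbf{P}_{\sigma_1,\sigma_2}(f=j)$, $j\in J$. For $\varepsilon\ge 0$ and a probability distribution $\nu$ on $J$, $M$ and $(\sigma_1,\sigma_2)$ $\varepsilon$-implement $\nu$ if $\|\mathbf{P}_{\sigma_1,\sigma_2,M}-\nu\|_\infty\le\varepsilon$. They $\varepsilon$-implement $\nu$ in a weak secure fashion if the following conditions hold: (W.1) $M$ and $(\sigma_1,\sigma_2)$ $\varepsilon$-implement $\nu$. (W.2) For every strategy $\sigma'_1\in\Sigma_1$ (and every $j\in J$), $\mathbf{P}_{\sigma'_1,\sigma_2,M}(j)\le\nu(j)$. (W.3) For every strategy $\sigma'_2\in\Sigma_2$ (and every $j\in J$), $\mathbf{P}_{\sigma_1,\sigma'_2,M}(j)\le\nu(j)$. (W.4) There are two disjoint events $D_1,D_2\subseteq H^\infty$ such that: $D_1\cup D_2\subseteq\{\tau=\infty\}$; $\mathbf{P}_{\sigma_1,\sigma_2}(D_1)=\mathbf{P}_{\sigma_1,\sigma_2}(D_2)=0$; for every $\sigma'_1\in\Sigma_1$, $\mathbf{P}_{\sigma'_1,\sigma_2}(D_1)+\mathbf{P}_{\sigma'_1,\sigma_2}(\{\tau<\infty\})=1$;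 and for every $\sigma'_2\in\Sigma_2$, $\mathbf{P}_{\sigma_1,\sigma'_2}(D_2)+\mathbf{P}_{\sigma_1,\sigma'_2}(\{\tau<\infty\})=1$. *)

(* Defs.v *)
From HB Require Import structures.
From mathcomp Require Import all_boot all_order all_algebra.
From mathcomp Require Import all_classical all_reals all_analysis.
From mathcomp Require Import lra.
Set Implicit Arguments.
Unset Strict Implicit.
Unset Printing Implicit Defensive.
Import Order.TTheory GRing.Theory Num.Theory.

Local Open Scope classical_set_scope.
Local Open Scope ring_scope.

Record dist (R : realType) (A : finType) := Dist {
  dist_fun :> A -> R;
  dist_ge0 : forall a, 0 <= dist_fun a;
  dist_sum1 : \sum_a dist_fun a = 1 }.

(* The cardinality proofs are arguments of the type because measurableType
   requires an inhabited carrier. *)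
Definition infhist (A1 A2 : finType) of (1 < #|A1|)%N & (1 < #|A2|)%N : Type :=
  nat -> A1 * A2.

Section histories.
Variables (A1 A2 : finType) (hA1 : (1 < #|A1|)%N) (hA2 : (1 < #|A2|)%N).
Local Notation Hoo := (infhist hA1 hA2).

Definition letter0 : A1 * A2 :=
  (enum_val (Ordinal (ltnW hA1)), enum_val (Ordinal (ltnW hA2))).

HB.instance Definition _ := gen_eqMixin Hoo.
HB.instance Definition _ := gen_choiceMixin Hoo.
HB.instance Definition _ := isPointed.Build Hoo (fun=> letter0).

(* The entry a^(n+1) of the history h is [h n]. *)
Definition coord_events (D : set nat) : set (set Hoo) :=
  [set E | exists2 n, D n & exists B : set (A1 * A2), E = [set h | B (h n)]].

HB.instance Definition _ := @isMeasurable.Build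
  (sigma_display (coord_events setT)) Hoo <<s coord_events setT >>
  (@sigma_algebra0 _ setT _) (@sigma_algebraC _ _)
  (@sigma_algebra_bigcup _ setT _).

Definition hist_filtration (t : nat) : set (set Hoo) :=
  <<s coord_events [set n | (n < t)%N] >>.

(* Stopping times take values in nat extended by infinity, encoded by [None]. *)
Definition tau_le (tau : Hoo -> option nat) (t : nat) : set Hoo :=
  [set h | exists2 n, tau h = Some n & (n <= t)%N].

Definition tau_finite (tau : Hoo -> option nat) : set Hoo :=
  [set h | exists n, tau h = Some n].

Definition tau_infinite (tau : Hoo -> option nat) : set Hoo :=
  [set h | tau h = None].

Definition is_stopping_time (tau : Hoo -> option nat) : Prop :=
  forall t, hist_filtration t (tau_le tau t).

Definition stopped_sigma_algebra (tau : Hoo -> option nat) : set (set Hoo) :=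
  [set E | measurable E /\ forall t, hist_filtration t (E `&` tau_le tau t)].

Record mechanism (J : finType) := Mechanism {
  mech_time : Hoo -> option nat;
  mech_out : Hoo -> J;
  mech_timeP : is_stopping_time mech_time;
  mech_outP : forall B : set J,
    stopped_sigma_algebra mech_time (mech_out @^-1` B) }.

Definition cylinder (w : seq (A1 * A2)) : set Hoo :=
  [set h | mkseq h (size w) = w].

End histories.

Arguments cylinder {A1 A2} hA1 hA2 w.

(* A strategy for the coordinate with alphabet A, where A is A1 or A2. *)
Definition strategy (R : realType) (A1 A2 A : finType) :=
  seq (A1 * A2) -> dist R A.

Definition stationary (R : realType) (A1 A2 A : finType)
    (s : strategy R A1 A2 A) : Prop :=
  forall w w' a, s w a = s w' a.

Section play.
Variables (R : realType) (A1 A2 : finType).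
Variables (hA1 : (1 < #|A1|)%N) (hA2 : (1 < #|A2|)%N).
Local Notation Hoo := (infhist hA1 hA2).
Variables (s1 : strategy R A1 A2 A1) (s2 : strategy R A1 A2 A2).

Definition induced_by_play (P : probability Hoo R) : Prop :=
  forall w a1 a2, P (cylinder hA1 hA2 (rcons w (a1, a2))) =
    (P (cylinder hA1 hA2 w) * (s1 w a1 * s2 w a2)%:E)%E.

Let X : finType := (A1 * A2)%type.
Let pt : X := letter0 hA1 hA2.
Let q (w : seq X) (x : X) : R := s1 w x.1 * s2 w x.2.

Let q_ge0 w x : 0 <= q w x.
Proof. by rewrite mulr_ge0 ?dist_ge0. Qed.

Let q_sum1 w : \sum_x q w x = 1.
Proof.
rewrite -(pair_big predT predT (fun a b => s1 w a * s2 w b)) /=.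
by under eq_bigr do rewrite -big_distrr /= dist_sum1 mulr1; exact: dist_sum1.
Qed.

(* The induced measure is obtained as the law, under the uniform distribution
   of u on [0, 1[, of the history whose next letter is read off from u by
   quantiles, u being then rescaled to [0, 1[. *)
Let cum w k : R := \sum_(0 <= i < k) q w (nth pt (enum X) i).
Let rk (x : X) := index x (enum X).

Let cumS w x : cum w (rk x).+1 = cum w (rk x) + q w x.
Proof. by rewrite /cum big_nat_recr //= nth_index ?mem_enum. Qed.

Let cum_le w k l : (k <= l)%N -> cum w k <= cum w l.
Proof.
move=> kl; rewrite /cum (big_cat_nat (leq0n k) kl) /= lerDl.
by apply: sumr_ge0.
Qed.

Let cum1 w : cum w #|X| = 1.
Proof.
rewrite -(q_sum1 w) -[RHS]big_enum /= (big_nth pt) /cum.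
by rewrite cardE.
Qed.

Let inI w u x := (cum w (rk x) <= u < cum w (rk x).+1).
Let pickl w u : X := odflt pt [pick x | inI w u x].

Let inI_exists w (u : R) : 0 <= u < 1 -> exists x, inI w u x.
Proof.
move=> /andP[u0 u1].
pose above k := u < cum w k.
have ex : exists k, above k by exists #|X|; rewrite /above cum1.
case: (ex_minnP ex) => -[|k] uk kmin.
  by move: uk; rewrite /above /cum big_geq // ltNge u0.
have kX : (k < #|X|)%N by apply: kmin; rewrite /above cum1.
exists (nth pt (enum X) k).
rewrite /inI /rk index_uniq ?enum_uniq -?cardE// -/(above _) uk andbT leNgt.
by apply/negP => /kmin; rewrite ltnn.
Qed.

Let inI_uniq w u x y : inI w u x -> inI w u y -> x = y.
Proof.
wlog xy : x y / (rk x <= rk y)%N.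
  move=> W ux uy; case/orP: (leq_total (rk x) (rk y)) => h; first exact: W.
  exact/esym/W.
move=> /andP[_ ux] /andP[uy _].
move: xy; rewrite leq_eqVlt => /orP[/eqP|/(cum_le w)]; last first.
  by move=> h; exfalso; lra.
by move/(congr1 (nth pt (enum X))); rewrite !nth_index ?mem_enum.
Qed.

Let picklP w (u : R) x : 0 <= u < 1 -> (pickl w u = x) <-> inI w u x.
Proof.
move=> u01; rewrite /pickl; case: pickP => [y uy|none] /=.
  by split=> [<-//|]; exact: inI_uniq.
by have [y] := inI_exists w u01; rewrite none.
Qed.

Let step (c : seq X * R) : seq X * R :=
  let x := pickl c.1 c.2 in
  (rcons c.1 x, (c.2 - cum c.1 (rk x)) / q c.1 x).

Let hist_of (c : seq X * R) : nat -> X :=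
  fun n => let d := iter n step c in pickl d.1 d.2.

Let hist_of0 c : hist_of c 0 = pickl c.1 c.2. Proof. by []. Qed.
Let hist_ofS c n : hist_of c n.+1 = hist_of (step c) n.
Proof. by rewrite /hist_of iterSr. Qed.

Let mkseq_hist_of c n :
  mkseq (hist_of c) n.+1 = hist_of c 0 :: mkseq (hist_of (step c)) n.
Proof.
have io : iota 1 n = map (addn 1) (iota 0 n) by rewrite -iotaDl.
rewrite /mkseq [iota 0 n.+1]/= [LHS]/= io -map_comp; congr cons.
by apply: eq_map => k /=; rewrite -hist_ofS.
Qed.

Let wt := fix wt (past w : seq X) {struct w} : R :=
  if w is x :: w' then q past x * wt (rcons past x) w' else 1.

Let wt_rcons past w x : wt past (rcons w x) = wt past w * q (past ++ w) x.
Proof.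
elim: w past => [|y w IH] past /=; first by rewrite cats0 mulr1 mul1r.
by rewrite IH cat_rcons mulrA.
Qed.

Let wt_ge0 past w : 0 <= wt past w.
Proof. by elim: w past => [|x w IH] past //=; rewrite mulr_ge0. Qed.

Let hist_of_interval past w : exists2 l : R, 0 <= l /\ l + wt past w <= 1 &
  forall u : R, 0 <= u < 1 ->
    (mkseq (hist_of (past, u)) (size w) = w) <-> (l <= u < l + wt past w).
Proof.
elim: w past => [|x w IH] past.
  by exists 0 => [|u u01]; rewrite /= add0r //; split => // _.
have [l [l0 l1] lP] := IH (rcons past x); rewrite [wt _ _]/=.
set p := wt _ w in l1 lP *.
have p0 : 0 <= p by exact: wt_ge0.
have Sx := cumS past x.
have [q0|qN0] := eqVneq (q past x) 0.
  exists 0; first by rewrite q0 mul0r addr0.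
  move=> u u01; rewrite q0 mul0r addr0; split; last by move=> h; exfalso; lra.
  rewrite [size _]/= mkseq_hist_of hist_of0 /= => -[/(picklP _ _ u01)].
  by rewrite /inI Sx q0; lra.
have qx : 0 < q past x by rewrite lt_def qN0 q_ge0.
have C0 : 0 <= cum past (rk x) by apply: sumr_ge0.
have C1 : cum past (rk x) + q past x <= 1.
  by rewrite -Sx -(cum1 past); apply: cum_le; rewrite cardE index_mem mem_enum.
exists (cum past (rk x) + q past x * l); first by split; nra.
move=> u u01; rewrite [size _]/= mkseq_hist_of hist_of0 [(past, u).1]/=.
rewrite [(past, u).2]/=.
have key : inI past u x -> 0 <= (u - cum past (rk x)) / q past x < 1.
  by rewrite /inI Sx ler_pdivlMr // ltr_pdivrMr // mul0r mul1r; lra.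
have key2 : l <= (u - cum past (rk x)) / q past x < l + p <->
    cum past (rk x) + q past x * l <= u <
    cum past (rk x) + q past x * l + q past x * p.
  by rewrite ler_pdivlMr // ltr_pdivrMr //; split; lra.
split.
  move=> [] hx; have ux := (picklP past x u01).1 hx.
  by rewrite /step /= hx => /(lP _ (key ux)) /key2.
move=> H; have ux : inI past u x by rewrite /inI Sx; nra.
have hx := (picklP past x u01).2 ux.
rewrite hx; congr cons; rewrite /step /= hx.
by apply/(lP _ (key ux))/key2.
Qed.

Let play_of (u : measurableTypeR R) : Hoo :=
  hist_of ([::], if 0 <= u < 1 then u else 0).

Let unit_itv : set (measurableTypeR R) := `[0, 1[%classic.
Let munit : measurable unit_itv. Proof. exact: measurable_itv. Qed.

Let play_of_cylinder w : exists l : R,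
  play_of @^-1` cylinder hA1 hA2 w `&` unit_itv = `[l, l + wt [::] w[%classic.
Proof.
have [l [l0 l1] lP] := hist_of_interval [::] w.
exists l; apply/seteqP; split => u /=; rewrite /unit_itv /= !in_itv /=.
  by move=> [+ u01]; rewrite /cylinder /= /play_of u01 => /(lP _ u01).
move=> lu; have u01 : 0 <= u < 1 by lra.
by split => //; rewrite /cylinder /= /play_of u01; apply/(lP _ u01).
Qed.

Let measurable_play_of_cylinder w :
  measurable (play_of @^-1` cylinder hA1 hA2 w).
Proof.
rewrite -(setIT (_ @^-1` _)) -(setUv unit_itv) setIUr; apply: measurableU.
  by have [l ->] := play_of_cylinder w; exact: measurable_itv.
have [h0|h0] := pselect (cylinder hA1 hA2 w (hist_of ([::], 0))).
  rewrite setIidr; first exact: measurableC.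
  move=> u /=; rewrite /unit_itv /= in_itv /= /play_of => /negP/negbTE ->.
  exact: h0.
suff -> : play_of @^-1` cylinder hA1 hA2 w `&` ~` unit_itv = set0.
  exact: measurable0.
apply/seteqP; split => u //= [].
rewrite /unit_itv /= in_itv /= /play_of => + /negP/negbTE E; rewrite E.
by move/h0.
Qed.

Let measurable_play_of : measurable_fun setT play_of.
Proof.
apply: (@measurability _ _ _ _ _ _ (coord_events (hA1:=hA1) (hA2:=hA2) setT)) => //.
move=> _ [_ [n _ [B ->]] <-]; rewrite setTI.
have -> : play_of @^-1` [set h | B (h n)] =
    \bigcup_(w : seq X) (if pselect (size w = n.+1 /\ B (nth pt w n))
       then play_of @^-1` cylinder hA1 hA2 w else set0).
  apply/seteqP; split => u /=.
    move=> Bu; pose w0 := mkseq (play_of u) n.+1.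
    have sz : size w0 = n.+1 by rewrite size_mkseq.
    have Bw : B (nth pt w0 n) by rewrite nth_mkseq.
    exists w0 => //; case: pselect => [?|[]]; last by [].
    by change (mkseq (play_of u) (size w0) = w0); rewrite sz.
  move=> [w _]; case: pselect => // -[sw Bw] /=.
  rewrite /cylinder /= sw => E; move: Bw.
  by rewrite -E nth_mkseq.
apply: countable_bigcupT_measurable; first exact: countableP.
by move=> w; case: pselect => ? /=; [exact: measurable_play_of_cylinder|exact: measurable0].
Qed.

Let play_law := pushforward (mrestr (@lebesgue_measure R) munit) play_of.

Let mplay E : measurable E -> measurable (play_of @^-1` E).
Proof.
by move=> mE; rewrite -[X in measurable X]setTI; exact: measurable_play_of.
Qed.

Let play_law0 : play_law set0 = 0%E.
Proof. by rewrite /play_law /pushforward preimage_set0 measure0. Qed.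

Let play_law_ge0 E : (0 <= play_law E)%E.
Proof. exact: measure_ge0. Qed.

Let play_law_sigma_additive : semi_sigma_additive play_law.
Proof.
move=> F mF tF mUF; rewrite /play_law /pushforward preimage_bigcup.
apply: measure_semi_sigma_additive => [n||]; first exact: mplay.
  apply/trivIsetP => i j _ _ ij; rewrite -preimage_setI.
  by move/trivIsetP : tF => /(_ _ _ _ _ ij) -> //; rewrite preimage_set0.
by rewrite -preimage_bigcup; exact: mplay.
Qed.

HB.instance Definition _ := isMeasure.Build _ _ _ play_law
  play_law0 play_law_ge0 play_law_sigma_additive.

Let play_law_setT : play_law setT = 1%E.
Proof.
rewrite /play_law /pushforward /mrestr preimage_setT setTI.
by rewrite /unit_itv lebesgue_measure_itv /= lte_fin ltr01 sube0.
Qed.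

HB.instance Definition _ :=
  Measure_isProbability.Build _ _ _ play_law play_law_setT.

Let play_lawE w : play_law (cylinder hA1 hA2 w) = (wt [::] w)%:E.
Proof.
rewrite /play_law /pushforward /mrestr /=.
have [l ->] := play_of_cylinder w.
rewrite lebesgue_measure_itv /= lte_fin ltrDl -EFinB.
case: ltP => [_|w0]; first by rewrite addrC addKr.
by congr EFin; apply/eqP; rewrite eq_le wt_ge0 w0.
Qed.

Lemma induced_by_play_exists : exists P, induced_by_play P.
Proof.
exists play_law => w a1 a2.
rewrite -[LHS]/(play_law _) -[X in (X * _)%E]/(play_law _) !play_lawE.
by rewrite wt_rcons EFinM.
Qed.

Lemma measurable_cylinder w : measurable (cylinder hA1 hA2 w).
Proof.
have -> : cylinder hA1 hA2 w =
    \bigcap_(i in [set i | (i < size w)%N]) [set h : Hoo | h i = nth pt w i].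
  apply/seteqP; split => h /=.
    by move=> E i /= iw; rewrite -E nth_mkseq.
  move=> E; apply: (@eq_from_nth _ pt); rewrite size_mkseq // => i iw.
  by rewrite nth_mkseq // E.
apply: bigcap_measurableType => i _; apply: sub_sigma_algebra.
by exists i => //; exists [set x | x = nth pt w i].
Qed.

Lemma induced_by_play_unique (P Q : probability Hoo R) :
  induced_by_play P -> induced_by_play Q ->
  forall E, measurable E -> P E = Q E.
Proof.
move=> HP HQ.
have cyl0 : cylinder hA1 hA2 [::] = setT by apply/seteqP; split.
have PQ w : P (cylinder hA1 hA2 w) = Q (cylinder hA1 hA2 w).
  elim/last_ind: w => [|w [a1 a2] IH]; first by rewrite cyl0 !probability_setT.
  by rewrite HP HQ IH.
pose G : set (set Hoo) :=
  [set E | E = set0 \/ exists w, E = cylinder hA1 hA2 w].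
apply: (@measure_unique _ R Hoo G (fun=> setT)).
- apply/seteqP; split; last first.
    apply: smallest_sub; first exact: sigma_algebra_measurable.
    by move=> _ [->|[w ->]]; [exact: measurable0|exact: measurable_cylinder].
  apply: smallest_sub; first exact: smallest_sigma_algebra.
  move=> _ [n _ [B ->]].
  have -> : [set h : Hoo | B (h n)] =
    \bigcup_(w : seq X) (if pselect (size w = n.+1 /\ B (nth pt w n))
       then cylinder hA1 hA2 w else set0).
    apply/seteqP; split => h /=.
      move=> Bu; pose w0 := mkseq h n.+1.
      have sz : size w0 = n.+1 by rewrite size_mkseq.
      have Bw : B (nth pt w0 n) by rewrite nth_mkseq.
      exists w0 => //; case: pselect => [?|[]]; last by [].
      by change (mkseq h (size w0) = w0); rewrite sz.
    move=> [w _]; case: pselect => // -[sw Bw] /=.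
    rewrite /cylinder /= sw => E; move: Bw.
    by rewrite -E nth_mkseq.
  apply: (@countable_bigcupT_measurable _ (g_sigma_algebraType G)).
    exact: countableP.
  move=> w; apply: sub_sigma_algebra.
  by case: pselect => ? /=; [right; exists w|left].
- move=> _ _ [->|[w ->]] [->|[v ->]]; rewrite ?setI0 ?set0I; try by left.
  wlog wv : w v / (size w <= size v)%N.
    move=> W; case/orP: (leq_total (size w) (size v)) => h; first exact: W.
    by rewrite setIC; apply: W.
  have tk (h : Hoo) : take (size w) (mkseq h (size v)) = mkseq h (size w).
    by rewrite /mkseq -map_take take_iota (minn_idPl wv).
  have [E|E] := eqVneq (take (size w) v) w; [right; exists v|left].
    apply/seteqP; split => h; first by case.
    by rewrite /cylinder /= => hv; split => //; rewrite -tk hv.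
  apply/seteqP; split => h //= [] hw hv; move/eqP: E; apply.
  by rewrite -hv tk.
- by move=> _; right; exists [::].
- by apply/seteqP; split => // h _; exists 0%N.
- by move=> _ [->|[w ->]]; [rewrite !measure0|exact: PQ].
- by move=> _; exact: le_lt_trans (probability_le1 P measurableT) (ltry 1).
Qed.

(* Well defined on events by [induced_by_play_unique]. *)
Definition play_prob : probability Hoo R := sval (cid induced_by_play_exists).

Lemma play_probP : induced_by_play play_prob.
Proof. exact: svalP (cid induced_by_play_exists). Qed.

End play.

Definition sup_norm (R : realType) (J : finType) (g : J -> R) : R :=
  \big[Num.max/0]_j `|g j|.

Section implementation.
Variables (R : realType) (A1 A2 J : finType).
Variables (hA1 : (1 < #|A1|)%N) (hA2 : (1 < #|A2|)%N).
Local Notation Hoo := (infhist hA1 hA2).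
Local Notation strat1 := (strategy R A1 A2 A1).
Local Notation strat2 := (strategy R A1 A2 A2).

(* [fine] reads a finite extended real as a real. *)
Definition outcome_law (mu : probability Hoo R) (M : mechanism hA1 hA2 J)
    (j : J) : R :=
  fine (mu [set h | mech_out M h = j]).

Definition play_outcome (s1 : strat1) (s2 : strat2)
    (M : mechanism hA1 hA2 J) : J -> R :=
  outcome_law (play_prob hA1 hA2 s1 s2) M.

Definition implements (eps : R) (M : mechanism hA1 hA2 J)
    (s1 : strat1) (s2 : strat2) (nu : dist R J) : Prop :=
  sup_norm (fun j => play_outcome s1 s2 M j - nu j) <= eps.

Definition deviation_detecting (M : mechanism hA1 hA2 J)
    (s1 : strat1) (s2 : strat2) : Prop :=
  let tau := mech_time M in
  let P := play_prob hA1 hA2 in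
  exists D1 D2 : set Hoo,
    [/\ [/\ measurable D1, measurable D2 & D1 `&` D2 = set0],
        D1 `|` D2 `<=` tau_infinite tau,
        P s1 s2 D1 = 0%E /\ P s1 s2 D2 = 0%E,
        forall s1' : strat1,
          (P s1' s2 D1 + P s1' s2 (tau_finite tau))%E = 1%E &
        forall s2' : strat2,
          (P s1 s2' D2 + P s1 s2' (tau_finite tau))%E = 1%E].

Definition weak_secure_implements (eps : R) (M : mechanism hA1 hA2 J)
    (s1 : strat1) (s2 : strat2) (nu : dist R J) : Prop :=
  [/\ implements eps M s1 s2 nu,
      forall (s1' : strat1) j, play_outcome s1' s2 M j <= nu j,
      forall (s2' : strat2) j, play_outcome s1 s2' M j <= nu j &
      deviation_detecting M s1 s2].

End implementation.

(* Main.v *)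
Require Import Defs.
From mathcomp Require Import all_boot all_order all_algebra.
From mathcomp Require Import all_classical all_reals all_analysis.
From mathcomp Require Import lra ring.
Import Order.TTheory GRing.Theory Num.Theory.
Local Open Scope ring_scope.

(* Fix letters x, y that s1, s2 choose with probabilities p, q <= 1/2, and let
   t(a, b) = U(a) W(b), where U(x) = 1, U = -p/(1-p) elsewhere, and W is built
   in the same way from y and q. Then t has mean zero as soon as one player is
   honest, whatever the other does, and pq <= |t| <= t(x, y) = 1. A point V of
   the simplex over J starts at nu; at each stage, if m is its second largest
   coordinate, the mass t m is moved from that coordinate to the largest one.
   Under a unilateral deviation each V_j remains a martingale, and the expected
   increase of the sum of the V_j^2 is at least (pq m)^2, so m tends to 0 and V
   converges to a vertex; that vertex is the outcome, and its law is nu. Each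
   occurrence of (x, y) empties a coordinate of V, so V is at a vertex once
   (x, y) has occurred #|J| times, which defines the stopping time. If play
   never stops, D1 is the event that y occurs infinitely often and D2 its
   complement: an honest player 2 plays y infinitely often, and against an
   honest player 1 infinitely many y produce infinitely many (x, y). *)

(** * Prefix-determined events and the drift lemma *)

Section Prefixes.
Local Open Scope classical_set_scope.
Set Implicit Arguments.
Unset Strict Implicit.
Unset Printing Implicit Defensive.
Variables (A1 A2 : finType) (hA1 : (1 < #|A1|)%N) (hA2 : (1 < #|A2|)%N).
Local Notation X := (A1 * A2)%type.
Local Notation Hoo := (infhist hA1 hA2).

(** There are countably many words, so the event is a countable union of cylinders of length n, each
    an intersection of coordinate events at indices below n. *)
Lemma hist_filtration_prefix n (B : set (seq X)) :
  hist_filtration n [set h : Hoo | B (mkseq h n)].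
Proof.
pose pt := letter0 hA1 hA2.
pose S := g_sigma_algebraType (coord_events (hA1 := hA1) (hA2 := hA2)
  [set k | (k < n)%N]).
have -> : [set h : Hoo | B (mkseq h n)] =
    \bigcup_(w : seq X) (if pselect (size w = n /\ B w)
       then cylinder hA1 hA2 w else set0).
  apply/seteqP; split => h /=.
    move=> Bh; exists (mkseq h n) => //.
    case: pselect => [?|[]]; last by rewrite size_mkseq.
    by rewrite /cylinder /= size_mkseq.
  move=> [w _]; case: pselect => // -[sw Bw] /=.
  by rewrite /cylinder /= sw => ->.
apply: (@countable_bigcupT_measurable _ S); first exact: countableP.
move=> w; case: pselect => [[sw _]|_] /=; last exact: (@measurable0 _ S).
have -> : cylinder hA1 hA2 w =
    \bigcap_(i in [set i | (i < n)%N]) [set h : Hoo | h i = nth pt w i].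
  apply/seteqP; split => h /=.
    by move=> E i /= iw; rewrite -E nth_mkseq // sw.
  move=> E; apply: (@eq_from_nth _ pt); rewrite size_mkseq // => i iw.
  by rewrite nth_mkseq // E // /= -sw.
apply: (@bigcap_measurableType _ S) => i ni; apply: sub_sigma_algebra.
by exists i => //; exists [set x | x = nth pt w i].
Qed.

Lemma measurable_prefix n (B : set (seq X)) :
  measurable [set h : Hoo | B (mkseq h n)].
Proof.
have sub : coord_events (hA1 := hA1) (hA2 := hA2) [set k | (k < n)%N] `<=`
    coord_events setT by move=> E [k _ Ek]; exists k.
exact: sub_sigma_algebra2 sub _ (hist_filtration_prefix (n := n) B).
Qed.

Section Drift.
Variables (R : realType) (s1 : strategy R A1 A2 A1) (s2 : strategy R A1 A2 A2).
Implicit Types (w : seq X) (g b : seq X -> R).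

(** Conditional expectation of g one stage ahead, given the history w; [later_mean] looks n stages
    ahead. Both are finite sums over words, so martingale arguments need no conditional expectation
    on infinite histories. *)
Definition next_mean w g : R := \sum_x s1 w x.1 * s2 w x.2 * g (rcons w x).

Fixpoint later_mean w n g : R :=
  if n is n'.+1 then \sum_x s1 w x.1 * s2 w x.2 * later_mean (rcons w x) n' g
  else g w.

Let q_ge0 w (x : X) : 0 <= s1 w x.1 * s2 w x.2.
Proof. by rewrite mulr_ge0 ?dist_ge0. Qed.

Lemma next_mean_split w g :
  next_mean w g = \sum_a s1 w a * \sum_b s2 w b * g (rcons w (a, b)).
Proof.
under eq_bigr do rewrite big_distrr; rewrite pair_big /=.
by apply: eq_bigr => -[a b] _ /=; rewrite mulrA.
Qed.

Lemma next_mean_cst w c : next_mean w (fun=> c) = c.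
Proof.
rewrite next_mean_split; under eq_bigr do rewrite -big_distrl /= dist_sum1
  mul1r.
by rewrite -big_distrl /= dist_sum1 mul1r.
Qed.

Lemma later_mean_le w n g g' :
  (forall w', g w' <= g' w') -> later_mean w n g <= later_mean w n g'.
Proof.
move=> gg'; elim: n w => [|n IH] w //=.
by apply: ler_sum => x _; rewrite ler_wpM2l.
Qed.

Lemma later_meanZ w n c g :
  later_mean w n (fun w' => c * g w') = c * later_mean w n g.
Proof.
elim: n w => [|n IH] w //=; rewrite big_distrr /=.
by apply: eq_bigr => x _; rewrite IH mulrCA.
Qed.

Lemma later_mean_cst w n c : later_mean w n (fun=> c) = c.
Proof.
by elim: n w => [|n IH] w //=; under eq_bigr do rewrite IH;
  exact: next_mean_cst.
Qed.

Lemma later_mean_harmonic w n g :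
  (forall w', next_mean w' g = g w') -> later_mean w n g = g w.
Proof.
move=> gP; elim: n w => [|n IH] w //=.
by under eq_bigr do rewrite IH; exact: gP.
Qed.

(** Telescoping: the first stage is paid for by the hypothesis at w, the later ones by induction
    from each successor of w, averaged over the next letter. *)
Lemma sum_later_mean_le w n g b :
  (forall w', g w' + next_mean w' b <= next_mean w' g) ->
  g w + \sum_(k < n) later_mean w k.+1 b <= later_mean w n g.
Proof.
move=> gb; elim: n w => [|n IH] w; first by rewrite big_ord0 addr0.
apply: (@le_trans _ _ (next_mean w g +
    \sum_x s1 w x.1 * s2 w x.2 * \sum_(k < n) later_mean (rcons w x) k.+1 b)).
  rewrite big_ord_recl addrA; apply: lerD; first exact: gb.
  under [leRHS]eq_bigr do rewrite big_distrr; rewrite exchange_big /=.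
  by [].
rewrite -big_split /=; apply: ler_sum => x _.
by rewrite -mulrDr ler_wpM2l.
Qed.

Variables (P : probability Hoo R) (HP : induced_by_play s1 s2 P).

(** The bridge from the measure to finite sums: the cylinder of w is split by the next letter, and
    [induced_by_play] supplies the weight of each piece. *)
Lemma prob_cylinder_prefix w n (B : pred (seq X)) :
  P (cylinder hA1 hA2 w `&` [set h | B (mkseq h (size w + n))]) =
  (P (cylinder hA1 hA2 w) * (later_mean w n (fun w' => (B w')%:R))%:E)%E.
Proof.
elim: n w => [|n IH] w.
  rewrite addn0 /=; case Bw: (B w); rewrite /= ?mule1 ?mule0.
    by congr (P _); apply/seteqP; split => h /= => [[]//|hw]; split => //;
      rewrite hw.
  rewrite (_ : _ `&` _ = set0) ?measure0 //.
  by apply/seteqP; split => h // [/= ->]; rewrite Bw.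
pose F x := cylinder hA1 hA2 (rcons w x) `&`
  [set h | B (mkseq h (size (rcons w x) + n))].
have -> : cylinder hA1 hA2 w `&` [set h | B (mkseq h (size w + n.+1))] =
    \bigcup_(x in [set: X]) F x.
  apply/seteqP; split => h /=.
    move=> [hw Bh]; exists (h (size w)) => //.
    by rewrite /F /cylinder /= size_rcons addSnnS mkseqS hw.
  move=> [x _]; rewrite /F /cylinder /= size_rcons addSnnS mkseqS => -[+ ->].
  by move/rcons_inj => [-> _].
rewrite measure_fin_bigcup //.
- have -> : [set: X] = [set` enum {: A1 * A2}] by apply/seteqP;
    split => x //= _; rewrite mem_enum.
  rewrite -fsbig_seq ?enum_uniq // big_enum /=.
  have HP' x : P (cylinder hA1 hA2 (rcons w x)) =
      (P (cylinder hA1 hA2 w) * (s1 w x.1 * s2 w x.2)%:E)%E by case: x.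
  under eq_bigr do rewrite IH HP' -muleA -EFinM.
  rewrite -sumEFin ge0_sume_distrr // => x _.
  rewrite lee_fin mulr_ge0 // (le_trans _ (later_mean_le (g := fun=> 0) _ _ _))
    //.
  by rewrite later_mean_cst.
- exact: finite_finset.
- move=> x y _ _ [h [[+ _] [+ _]]].
  rewrite /cylinder /= !size_rcons => E1 E2; have := etrans (esym E1) E2.
  by move/rcons_inj => -[].
- move=> x _; apply: measurableI; first exact: measurable_cylinder.
  exact: measurable_prefix [set w' | B w'].
Qed.

Lemma prob_prefix n (B : pred (seq X)) :
  P [set h | B (mkseq h n)] = (later_mean [::] n (fun w => (B w)%:R))%:E.
Proof.
have := prob_cylinder_prefix [::] n B.
have -> : cylinder hA1 hA2 [::] = setT by apply/seteqP; split.
by rewrite setTI probability_setT mul1e.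
Qed.

(* The drift telescopes, so the expected values of b along the play have a sum
   at most C - g [::]; conclude by Markov and Borel-Cantelli. *)
Lemma drift_null g b (C eps : R) : 0 < eps ->
  (forall w, 0 <= b w) -> (forall w, g w <= C) ->
  (forall w, g w + next_mean w b <= next_mean w g) ->
  P (lim_sup_set (fun n => [set h | eps <= b (mkseq h n.+1)])) = 0%E.
Proof.
move=> eps0 b0 gC gb; apply: lim_sup_set_cvg0.
  by move=> k; exact: measurable_prefix [set w | eps <= b w].
apply: (@le_lt_trans _ _ ((C - g [::]) / eps)%:E); last exact: ltry.
apply: lime_le; first exact: is_cvg_nneseries.
apply: nearW => n; rewrite big_mkord.
rewrite (eq_bigr (fun k : 'I_n =>
    (later_mean [::] k.+1 (fun w => (eps <= b w)%R%:R))%:E)); last first.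
  by move=> k _; exact: (prob_prefix k.+1 (fun w => eps <= b w)).
rewrite sumEFin lee_fin ler_pdivlMr // mulrC big_distrr /=.
have := sum_later_mean_le [::] n gb.
have := later_mean_le [::] n gC; rewrite later_mean_cst.
suff : \sum_(k < n) eps * later_mean [::] k.+1 (fun w => (eps <= b w)%R%:R) <=
    \sum_(k < n) later_mean [::] k.+1 b by rewrite -/later_mean; lra.
apply: ler_sum => k _; rewrite -later_meanZ; apply: later_mean_le => w.
case: (leP eps (b w)) => [eb|_] /=; last by rewrite mulr0.
by rewrite mulr1.
Qed.

End Drift.
End Prefixes.

(** * Visits to letters *)

Section Limits.
Local Open Scope classical_set_scope.
Set Implicit Arguments.
Unset Strict Implicit.
Unset Printing Implicit Defensive.
Variables (A1 A2 : finType) (hA1 : (1 < #|A1|)%N) (hA2 : (1 < #|A2|)%N).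
Local Notation X := (A1 * A2)%type.
Local Notation Hoo := (infhist hA1 hA2).

Lemma measurable_forall_prefix (B : set (seq X)) :
  measurable [set h : Hoo | forall n, B (mkseq h n)].
Proof.
rewrite (_ : [set _ | _] = \bigcap_n [set h : Hoo | B (mkseq h n)]).
  by apply: bigcapT_measurable => n; exact: measurable_prefix.
by apply/seteqP; split => h Bh n => [_|]; [exact: Bh | exact: Bh n I].
Qed.

Lemma measurable_eventually_prefix (B : set (seq X)) :
  measurable [set h : Hoo | exists N, forall n, (N <= n)%N -> B (mkseq h n)].
Proof.
(* Turning the bound [N <= n] into a condition on the length of the prefix leaves, for each N, a
   requirement on all prefixes. *)
rewrite (_ : [set _ | _] = \bigcup_N
    [set h : Hoo | forall n, [set w | (N <= size w)%N -> B w] (mkseq h n)]).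
  by apply: bigcupT_measurable => N; exact: measurable_forall_prefix.
apply/seteqP; split => h [N]; last move=> _.
  by move=> BN; exists N => // n /=; rewrite size_mkseq; exact: BN.
by move=> BN; exists N => n Nn; have := BN n; rewrite /= size_mkseq; apply.
Qed.

Lemma measurable_bounded_visits (y : A2) :
  measurable [set h : Hoo | exists N, forall n,
    (count (fun x => x.2 == y) (mkseq h n) < N)%N].
Proof.
rewrite (_ : [set _ | _] = \bigcup_N [set h : Hoo | forall n,
    (count (fun x => x.2 == y) (mkseq h n) < N)%N]).
  apply: bigcupT_measurable => N.
  exact: (measurable_forall_prefix
    [set w | (count (fun x => x.2 == y) w < N)%N]).
by apply/seteqP; split => h; [move=> [N hN]; exists N|move=> [N _ hN];
  exists N].
Qed.

Lemma measurable_lim_sup_prefix (B : set (seq X)) (k : nat -> nat) :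
  measurable (lim_sup_set (fun n => [set h : Hoo | B (mkseq h (k n))])).
Proof.
apply: bigcapT_measurable => n; apply: bigcup_measurable => m _.
exact: measurable_prefix.
Qed.

Variables (R : realType) (s1 : strategy R A1 A2 A1) (s2 : strategy R A1 A2 A2).
Variables (P : probability Hoo R) (HP : induced_by_play s1 s2 P).

Lemma next_mean_le w (g g' : seq X -> R) :
  (forall x, g (rcons w x) <= g' (rcons w x)) ->
  next_mean s1 s2 w g <= next_mean s1 s2 w g'.
Proof. by move=> gg'; apply: ler_sum => x _; rewrite ler_wpM2l // mulr_ge0
  ?dist_ge0. Qed.

(** The number of visits to A, capped at N, is a bounded potential whose drift is the chance of A
    while the cap is not reached. *)
Lemma count_drift_null (A : pred X) (N : nat) (b : seq X -> R) (eps : R) :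
  0 < eps -> (forall w, 0 <= b w) ->
  (forall w, next_mean s1 s2 w b <=
     if (count A w < N)%N then \sum_(x | A x) s1 w x.1 * s2 w x.2 else 0) ->
  P (lim_sup_set (fun n => [set h | eps <= b (mkseq h n.+1)])) = 0%E.
Proof.
move=> eps0 b0 bA.
apply: (@drift_null _ _ _ _ _ _ _ _ HP (fun w => (minn (count A w) N)%:R) b
  N%:R) => //.
  by move=> w; rewrite ler_nat geq_minr.
move=> w; apply: le_trans (lerD (lexx _) (bA w)) _.
rewrite -[X in X + _](next_mean_cst s1 s2 w) /next_mean.
case: ltnP => cN; last first.
  rewrite addr0; apply: ler_sum => x _; rewrite ler_wpM2l ?mulr_ge0 ?dist_ge0
    //.
  by rewrite ler_nat -cats1 count_cat leq_min leqnn andbT (leq_trans cN)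
    ?leq_addr.
rewrite [X in _ + X <= _]big_mkcond -big_split /=; apply: ler_sum => x _.
rewrite -cats1 count_cat /= addn0.
case: (A x); last by rewrite addr0 addn0 (minn_idPl (ltnW cN)).
by rewrite addn1 (minn_idPl cN) -natr1 mulrDr mulr1.
Qed.

(** Let b be q until the N-th visit. On this event b equals q forever, whereas almost surely b
    reaches q only finitely often. *)
Lemma count_visits_null (y : A2) (q : R) (N : nat) :
  0 < q -> (forall w, s2 w y = q) ->
  P [set h | forall n, (count (fun x => x.2 == y) (mkseq h n) < N)%N] = 0%E.
Proof.
move=> q0 s2y; pose A := [pred x : X | x.2 == y].
pose b w : R := if (count A w < N)%N then q else 0.
have b0 w : 0 <= b w by rewrite /b; case: ifP => // _; exact: ltW.
have sA w : \sum_(x | A x) s1 w x.1 * s2 w x.2 = q.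
  rewrite -(pair_big predT (pred1 y) (fun a b => s1 w a * s2 w b)) /=.
  under eq_bigr do rewrite big_pred1_eq s2y.
  by rewrite -big_distrl /= dist_sum1 mul1r.
have bA w : next_mean s1 s2 w b <=
     if (count A w < N)%N then \sum_(x | A x) s1 w x.1 * s2 w x.2 else 0.
  rewrite sA -(next_mean_cst s1 s2 w (if _ then _ else _)).
  apply: next_mean_le => x; rewrite /b -cats1 count_cat.
  case: (ltnP (count A w) N) => cN; first by case: ifP => // _; exact: ltW.
  by rewrite ltnNge (leq_trans cN) ?leq_addr.
apply: subset_measure0 (count_drift_null q0 b0 bA).
- exact: (measurable_forall_prefix [set w | (count A w < N)%N]).
- exact: (measurable_lim_sup_prefix [set w | q <= b w] S).
- by move=> h /= hN n _; exists n => //=; rewrite /b hN.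
Qed.

Lemma bounded_visits_null (y : A2) (q : R) :
  0 < q -> (forall w, s2 w y = q) ->
  P [set h | exists N, forall n, (count (fun x => x.2 == y) (mkseq h n) < N)%N]
    = 0%E.
Proof.
move=> q0 s2y; apply: measure_negligible; first exact:
  measurable_bounded_visits.
apply: (@negligibleS _ _ _ _ (\bigcup_N [set h : Hoo | forall n,
  (count (fun x => x.2 == y) (mkseq h n) < N)%N])).
  by move=> h [N hN]; exists N.
apply: negligible_bigcup => N; apply/negligibleP.
  exact: (measurable_forall_prefix
    [set w | (count (fun x => x.2 == y) w < N)%N]).
exact: count_visits_null q0 s2y.
Qed.

Lemma rare_meeting_null (x : A1) (y : A2) (p : R) (N : nat) :
  0 < p -> (forall w, s1 w x = p) ->
  P [set h | (forall n, (count_mem (x, y) (mkseq h n) < N)%N) /\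
    ~ exists M, forall n, (count (fun z => z.2 == y) (mkseq h n) < M)%N] = 0%E.
Proof.
move=> p0 s1x; pose A := pred1 (x, y).
(* A charge of p for each y played: the two letters are chosen independently, so its mean is at most
   the chance of (x, y). Only values at nonempty histories count, so the default of [last] is
   harmless. *)
pose b w : R := if ((last (x, y) w).2 == y) && (count A w < N)%N then p else 0.
have b0 w : 0 <= b w by rewrite /b; case: ifP => // _; exact: ltW.
have bA w : next_mean s1 s2 w b <=
     if (count A w < N)%N then \sum_(z | A z) s1 w z.1 * s2 w z.2 else 0.
  rewrite big_pred1_eq /= s1x.
  pose b' (z : X) : R := if (z.2 == y) && (count A w < N)%N then p else 0.
  apply: (@le_trans _ _ (\sum_z s1 w z.1 * s2 w z.2 * b' z)).
    apply: ler_sum => z _; rewrite ler_wpM2l ?mulr_ge0 ?dist_ge0 // /b /b'.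
    rewrite last_rcons; case: (z.2 == y) => //=.
    rewrite -cats1 count_cat; case: (ltnP (count A w) N) => cN.
      by case: ifP => // _; exact: ltW.
    by rewrite ltnNge (leq_trans cN) ?leq_addr.
  rewrite -(pair_big predT predT (fun a b => s1 w a * s2 w b * b' (a, b))) /=.
  rewrite /b'; case: ltnP => _; last first.
    by rewrite big1 // => a _; rewrite big1 // => c _; rewrite andbF mulr0.
  under eq_bigr => a _.
    rewrite (bigD1 y) //= big1 ?addr0 => [|c /negbTE ->]; last by rewrite mulr0.
    rewrite eqxx -mulrA; over.
  by rewrite -big_distrl /= dist_sum1 mul1r mulrC.
have mC := measurable_forall_prefix [set w | (count A w < N)%N].
apply: subset_measure0 (count_drift_null p0 b0 bA).
- apply: measurableI => //; apply: measurableC.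
  exact: measurable_bounded_visits.
- exact: (measurable_lim_sup_prefix [set w | p <= b w] S).
(* The meetings stay below N, so if b is below p from index n on, then y never occurs from position
   n on and its count is at most n. *)
- move=> h /= [hN hM] n _; apply/not_exists2P => nob; apply: hM;
    exists n.+1 => m.
  have no k : (n <= k)%N -> (h k).2 != y.
    move=> nk; apply/negP => hk; case: (nob k) => // /negP/=.
    by rewrite /b hN mkseqS last_rcons hk lexx.
  rewrite ltnS; elim: m => [|m IH] //.
  rewrite mkseqS -cats1 count_cat /= addn0.
  case: (leqP n m) => nm; first by rewrite (negbTE (no _ nm)) addn0.
  apply: leq_trans nm; rewrite -addn1 leq_add ?leq_b1 //.
  by rewrite -[leqRHS](size_mkseq h) count_size.
Qed.
End Limits.

(** * Mass transfers on the simplex *)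

Section Transfers.
Set Implicit Arguments.
Unset Strict Implicit.
Unset Printing Implicit Defensive.
Variables (R : realType) (J : finType) (hJ : (1 < #|J|)%N).
Implicit Types (v : J -> R) (t : R).

Definition simplex v := (forall k, 0 <= v k) /\ \sum_k v k = 1.

Lemma top_two_exists v : exists ij : J * J,
  [/\ ij.1 != ij.2, v ij.1 <= v ij.2 & forall k, k != ij.2 -> v k <= v ij.1].
Proof.
pose a := enum_val (Ordinal (ltnW hJ)); pose b := enum_val (Ordinal hJ).
have ab : a != b by apply/eqP => /enum_val_inj.
pose j := [arg max_(j > a) v j]%O.
have jP k : v k <= v j by rewrite /j; case: arg_maxP => // i _; apply.
have [i0 i0j] : exists i0, i0 != j.
  by have [ja|ja] := eqVneq a j; [exists b; rewrite -ja eq_sym | exists a].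
exists ([arg max_(i > i0 | i != j) v i]%O, j) => /=.
by case: arg_maxP => // i ij iP; split.
Qed.

(** First component the runner-up, second the leader; ties are broken by choice. *)
Definition top_two v : J * J := sval (cid (top_two_exists v)).
Definition second v : R := v (top_two v).1.
Definition transfer_dir v (k : J) : R :=
  (k == (top_two v).2)%:R - (k == (top_two v).1)%:R.
Definition transfer v t (k : J) : R := v k + t * second v * transfer_dir v k.

Lemma top_twoP v : [/\ (top_two v).1 != (top_two v).2,
  second v <= v (top_two v).2 &
  forall k, k != (top_two v).2 -> v k <= second v].
Proof. exact: svalP (cid (top_two_exists v)). Qed.

Lemma second_ge0 v : simplex v -> 0 <= second v.
Proof. by move=> [v0 _]; exact: v0. Qed.

Lemma sum_transfer_dir v : \sum_k transfer_dir v k = 0.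
Proof.
have s i : \sum_k (k == i)%:R = 1 :> R.
  by rewrite (bigD1 i) //= eqxx big1 ?addr0 // => k /negbTE ->.
by rewrite sumrB !s subrr.
Qed.

Lemma transfer_dir_le1 v k : `|transfer_dir v k| <= 1.
Proof.
rewrite /transfer_dir; do 2 case: eqP => _;
by rewrite ?subrr ?sub0r ?subr0 ?normrN ?normr0 ?normr1.
Qed.

Lemma transfer_ge v t k : simplex v -> `|t| <= 1 -> v k - second v <= transfer v
    t k.
Proof.
move=> sv t1; rewrite lerD2l lerNl -mulrN mulrAC.
apply: le_trans (ler_norm _) _; rewrite !normrM normrN.
rewrite (ger0_norm (second_ge0 sv)) ler_piMl ?second_ge0 //.
by rewrite mulr_ile1 ?transfer_dir_le1.
Qed.

(** The amount moved is at most [second v] in absolute value, and neither leader nor runner-up holds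
    less, so both stay nonnegative even when a negative t reverses the transfer. *)
Lemma transfer_simplex v t : simplex v -> `|t| <= 1 -> simplex (transfer v t).
Proof.
move=> sv t1; have [ij vij vk] := top_twoP v; have [v0 v1] := sv.
split=> [k|]; last by rewrite big_split /= v1 -big_distrr /= sum_transfer_dir
  mulr0 addr0.
have [->|kj] := eqVneq k (top_two v).2.
  by apply: le_trans (transfer_ge _ sv t1); rewrite subr_ge0.
rewrite /transfer /transfer_dir (negbTE kj).
have [->|ki] := eqVneq k (top_two v).1; last by rewrite subrr mulr0 addr0.
have := second_ge0 sv; move: t1; rewrite ler_norml -/(second v) => /andP[? ?] ?.
rewrite mulr0n mulr1n; nra.
Qed.

(** Otherwise k and the leader would together hold more than 1. *)
Lemma top_gt_half v k : simplex v -> 1 / 2 < v k -> k = (top_two v).2.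
Proof.
move=> [v0 v1] vk; apply/eqP/contraT => kj.
have [_ vij /(_ _ kj) vki] := top_twoP v.
move: v1; rewrite (bigD1 k) //= (bigD1 (top_two v).2) 1?eq_sym //=.
have : 0 <= \sum_(i | (i != k) && (i != (top_two v).2)) v i by apply: sumr_ge0.
lra.
Qed.

Lemma top_ge v : simplex v -> 1 - #|J|%:R * second v <= v (top_two v).2.
Proof.
move=> sv; have [v0 v1] := sv; have [_ _ vk] := top_twoP v.
rewrite lerBlDr -[leLHS]v1 (bigD1 (top_two v).2) //= lerD2l.
apply: (@le_trans _ _ (\sum_(k : J) second v)); last by rewrite sumr_const
  mulr_natl.
rewrite [leRHS](bigD1 (top_two v).2) //= -[leLHS]add0r lerD ?second_ge0 //.
by apply: ler_sum => k; exact: vk.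
Qed.

Lemma transfer0 v t : second v = 0 -> transfer v t = v.
Proof. by move=> v0; apply/funext => k; rewrite /transfer v0 mulr0 mul0r addr0.
  Qed.

(** The coefficient c of the linear term may stay unspecified: it does not depend on t, so the term
    averages out when t is centered. The factor 2 is the squared norm of [transfer_dir v]. *)
Lemma sum_sqr_transfer v : exists c, forall t,
  \sum_k transfer v t k ^+ 2 = \sum_k v k ^+ 2 + t * c + 2 * (t * second v) ^+
    2.
Proof.
exists (2 * second v * \sum_k v k * transfer_dir v k) => t.
have d2 : \sum_k transfer_dir v k ^+ 2 = 2.
  have [ij _ _] := top_twoP v; rewrite /transfer_dir.
  rewrite (bigD1 (top_two v).2) //= (bigD1 (top_two v).1) //= big1.
    rewrite !eqxx (negbTE ij) [_.2 == _]eq_sym (negbTE ij) mulr0n mulr1n.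
    by rewrite subr0 sub0r sqrrN expr1n addr0.
  by move=> k /andP[/negbTE -> /negbTE ->]; rewrite subrr expr0n.
rewrite -[X in X * (t * _) ^+ 2]d2 [t * _]mulrA mulr_sumr mulr_suml -!big_split
  /=.
apply: eq_bigr => k _.
rewrite /transfer; ring.
Qed.

Definition support_size v := #|[pred k | v k != 0]|.

(** Unless [second v] vanishes and nothing moves, an empty coordinate is neither leader nor
    runner-up. Hence supports never grow. *)
Lemma transfer_eq0 v t k : simplex v -> v k = 0 -> transfer v t k = 0.
Proof.
move=> sv vk0; have [s0|s0] := eqVneq (second v) 0; first by rewrite transfer0.
have [ij vij vk] := top_twoP v.
have ki : k != (top_two v).1 by apply: contra s0 => /eqP ki;
    rewrite /second -ki vk0.
have kj : k != (top_two v).2.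
  apply: contra s0 => /eqP kj; move: vij; rewrite -kj vk0 => sle.
  by rewrite eq_le sle second_ge0.
by rewrite /transfer /transfer_dir (negbTE ki) (negbTE kj) subrr mulr0 vk0
  addr0.
Qed.

Lemma support_transfer v t : simplex v -> (support_size (transfer v t) <=
    support_size v)%N.
Proof.
move=> sv; rewrite /support_size subset_leq_card //;
  apply/fintype.subsetP => k; rewrite !inE.
by apply: contra => /eqP vk0; rewrite transfer_eq0.
Qed.

(** With t = 1 the runner-up gives away all its mass. *)
Lemma support_transfer1 v : simplex v -> second v != 0 ->
  (support_size (transfer v 1) < support_size v)%N.
Proof.
move=> sv s0; have [ij _ _] := top_twoP v.
apply/proper_card/properP; split.
  by apply/fintype.subsetP => k; rewrite !inE; apply: contra => /eqP vk0;
    rewrite transfer_eq0.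
exists (top_two v).1; first by rewrite inE.
rewrite inE negbK /transfer /transfer_dir (negbTE ij) eqxx mul1r sub0r mulrN1.
by rewrite subrr.
Qed.

Section Walk.
Variables (X : eqType) (t : X -> R) (x0 : X) (nu : J -> R).
Hypotheses (nuP : simplex nu) (t_le1 : forall x, `|t x| <= 1) (tx0 : t x0 = 1).

Definition lottery (w : seq X) : J -> R := foldl (fun v x => transfer v (t x))
  nu w.

Lemma lottery_rcons w x : lottery (rcons w x) = transfer (lottery w) (t x).
Proof. by rewrite /lottery foldl_rcons. Qed.

Lemma lottery_simplex w : simplex (lottery w).
Proof.
elim/last_ind: w => [|w x IH]; first exact: nuP.
by rewrite lottery_rcons; exact: transfer_simplex.
Qed.

Lemma lottery_degenerate w : (#|J| <= count_mem x0 w)%N -> second (lottery w) =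
    0.
Proof.
(* Until a vertex is reached, each [x0] removes a coordinate from the support; #|J| removals would
   empty it, which total mass 1 forbids. *)
have inv : second (lottery w) = 0 \/
    (support_size (lottery w) + count_mem x0 w <= #|J|)%N.
  elim/last_ind: w => [|w x IH]; first by right; rewrite addn0 max_card.
  rewrite lottery_rcons -cats1 count_cat /= addn0.
  have [s0|s0] := eqVneq (second (lottery w)) 0; first by left;
      rewrite transfer0.
  case: IH => [/eqP|IH]; first by rewrite (negbTE s0).
  right; apply: leq_trans IH; have [->|xx0] := eqVneq x x0.
    rewrite tx0 addn1 addnS -addSn leq_add2r.
    exact: support_transfer1 (lottery_simplex w) s0.
  by rewrite addn0 leq_add2r; exact: support_transfer (lottery_simplex w).
move=> cJ; case: inv => // inv.
have : support_size (lottery w) = 0%N.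
  by apply/eqP; rewrite -leqn0 -(leq_add2r #|J|) (leq_trans _ inv) // leq_add2l.
move/card0_eq => s0; have := (lottery_simplex w).2; rewrite big1.
  by move/esym/eqP; rewrite oner_eq0.
by move=> k _; have := s0 k; rewrite !inE => /negbFE/eqP.
Qed.

End Walk.
End Transfers.

(** * The law of the limit vertex *)

Section Outcome.
Local Open Scope classical_set_scope.
Set Implicit Arguments.
Unset Strict Implicit.
Unset Printing Implicit Defensive.
Variables (A1 A2 : finType) (hA1 : (1 < #|A1|)%N) (hA2 : (1 < #|A2|)%N).
Local Notation X := (A1 * A2)%type.
Local Notation Hoo := (infhist hA1 hA2).
Variables (R : realType) (J : finType) (hJ : (1 < #|J|)%N).
Variables (t : X -> R) (nu : J -> R).
Hypotheses (nuP : simplex nu) (t_le1 : forall x, `|t x| <= 1).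
Local Notation lottery := (lottery hJ t nu).

(** Convergence to the vertex j is replaced by staying above 1/2 eventually: at most one j
    qualifies, and the event is expressed through prefixes. *)
Definition winner (j : J) : set Hoo := [set h | exists N, forall n, (N <= n)%N
  ->
  1 / 2 < lottery (mkseq h n) j].

Definition outcome (h : Hoo) : J :=
  if pselect (exists j, winner j h) is left e then sval (cid e)
  else enum_val (Ordinal hJ).

Lemma winner_uniq h j k : winner j h -> winner k h -> j = k.
Proof.
move=> [N hN] [M hM]; pose n := maxn N M.
have sl := lottery_simplex hJ nuP t_le1 (mkseq h n).
rewrite (top_gt_half hJ sl (hN n (leq_maxl _ _))).
by rewrite [RHS](top_gt_half hJ sl (hM n (leq_maxr _ _))).
Qed.

Lemma outcome_winner h j : winner j h -> outcome h = j.
Proof.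
move=> jh; rewrite /outcome; case: pselect => [e|[]]; last by exists j.
exact: winner_uniq (svalP (cid e)) jh.
Qed.

Lemma measurable_winner j : measurable (winner j).
Proof. exact: (measurable_eventually_prefix [set w | 1 / 2 < lottery w j]). Qed.

Lemma measurable_outcome (B : set J) : measurable (outcome @^-1` B).
Proof.
pose j0 := enum_val (Ordinal hJ).
have mW : measurable (\bigcup_j winner j).
  by apply: countable_bigcupT_measurable => [|j]; [exact: countableP | exact:
    measurable_winner].
rewrite (_ : _ @^-1` _ = (\bigcup_j (if pselect (B j) then winner j else set0))
  `|`
   (if pselect (B j0) then ~` (\bigcup_j winner j) else set0)).
  apply: measurableU.
    apply: countable_bigcupT_measurable => [|j]; first exact: countableP.
    by case: pselect => ?; [exact: measurable_winner | exact: measurable0].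
  by case: pselect => ?; [exact: measurableC | exact: measurable0].
apply/seteqP; split => h /=.
  rewrite /outcome; case: pselect => [e|ne] Bh.
    left; exists (sval (cid e)) => //.
    case: pselect => [Bj|]; last by case.
    exact: svalP (cid e).
  right; case: pselect => [Bj|]; last by case.
  by case=> j _ jh; apply: ne; exists j.
case=> [[j _]|]; first by case: pselect => // Bj /outcome_winner ->.
case: pselect => // Bj0 nW; rewrite /outcome; case: pselect => // -[j jh].
by case: nW; exists j.
Qed.

Variables (c : R) (s1 : strategy R A1 A2 A1) (s2 : strategy R A1 A2 A2).
Hypotheses (c_gt0 : 0 < c) (t_ge : forall x, c <= `|t x|).
Hypothesis t_centered : forall w, \sum_x s1 w x.1 * s2 w x.2 * t x = 0.
Variables (P : probability Hoo R) (HP : induced_by_play s1 s2 P).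

(** The martingale property: given w, the increment is t times a factor fixed by w. *)
Lemma next_mean_lottery w j : next_mean s1 s2 w (fun w' => lottery w' j) =
    lottery w j.
Proof.
rewrite -[RHS](next_mean_cst s1 s2 w); apply/eqP; rewrite -subr_eq0 -sumrB.
under eq_bigr do rewrite -mulrBr lottery_rcons /transfer addrC addKr !mulrA.
by rewrite -!mulr_suml t_centered !mul0r.
Qed.

Lemma second_vanishes (eps : R) : 0 < eps ->
  P (lim_sup_set (fun n => [set h | eps <= second hJ (lottery (mkseq h n))])) =
    0%E.
Proof.
move=> e0; pose g w := \sum_k lottery w k ^+ 2.
(* The drift lemma charges b after a stage, while the gain in squares depends on the runner-up
   before it; hence the last letter is dropped. *)
pose b w := (c * second hJ (lottery (take (size w).-1 w))) ^+ 2.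
have c0 := c_gt0.
have : P (lim_sup_set (fun n => [set h | (c * eps) ^+ 2 <= b (mkseq h n.+1)])) =
    0%E.
  apply: (@drift_null _ _ _ _ _ _ _ _ HP g b #|J|%:R).
  - by rewrite exprn_gt0 // mulr_gt0.
  - by move=> w; rewrite sqr_ge0.
  - move=> w; rewrite -sum1_card natr_sum; apply: ler_sum => k _.
    have [v0 v1] := lottery_simplex hJ nuP t_le1 w.
    rewrite expr_le1 // -v1 (bigD1 k) //= lerDl.
    by apply: sumr_ge0.
  - move=> w; set v := lottery w.
    have bw x : b (rcons w x) = (c * second hJ v) ^+ 2.
      by rewrite /b size_rcons /= -cats1 take_size_cat.
    have [d dP] := sum_sqr_transfer hJ v.
    rewrite -[X in X + _](next_mean_cst s1 s2 w).
    (* Adding the zero mean of [t x * d] cancels the linear term, so that the inequality holds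
       letter by letter. *)
    rewrite -[leLHS]addr0 -[X in _ + X](mul0r d) -(t_centered w) mulr_suml.
    rewrite /next_mean -!big_split /=; apply: ler_sum => x _.
    rewrite -[_ * t x * d]mulrA -!mulrDr ler_wpM2l ?mulr_ge0 ?dist_ge0 //.
    rewrite bw /g lottery_rcons dP -/v addrAC lerD2l !exprMn.
    have : c ^+ 2 <= t x ^+ 2 by rewrite -[leRHS]real_normK ?num_real // lerXn2r
        ?nnegrE // ltW.
    have := sqr_ge0 (second hJ v); have := sqr_ge0 (t x); nra.
apply: subset_measure0.
- exact: (measurable_lim_sup_prefix [set w | eps <= second hJ (lottery w)] id).
- exact: (measurable_lim_sup_prefix [set w | (c * eps) ^+ 2 <= b w] S).
- move=> h hP n _; have [m nm em] := hP n I; exists m => //=.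
  rewrite /b size_mkseq /= mkseqS -cats1 take_size_cat ?size_mkseq //.
  have s0 := second_ge0 hJ (lottery_simplex hJ nuP t_le1 (mkseq h m)).
  have cs : c * eps <= c * second hJ (lottery (mkseq h m)) by rewrite ler_pM2l.
  by rewrite lerXn2r // nnegrE mulr_ge0 // ltW.
Qed.

Lemma outcome_settled h j (e : R) : 0 < e -> e < 1 / 4 ->
  ~ lim_sup_set (fun n => [set h' : Hoo | e / #|J|%:R <= second hJ (lottery
    (mkseq h' n))]) h ->
  outcome h = j -> exists N, forall n, (N <= n)%N -> 1 - e <= lottery (mkseq h
    n) j.
Proof.
move=> e0 e1 nS hj.
have J0 : 0 < #|J|%:R :> R by rewrite ltr0n ltnW.
have [N hN] : exists N, forall n, (N <= n)%N ->
    #|J|%:R * second hJ (lottery (mkseq h n)) < e.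
  apply: contrapT => nN; apply: nS => N _; apply/not_exists2P => H.
  apply: nN; exists N => n Nn; rewrite mulrC -ltr_pdivlMr // ltNge;
    apply/negP => en.
  by case: (H n); apply.
have top n : (N <= n)%N ->
    1 - e <= lottery (mkseq h n) (top_two hJ (lottery (mkseq h n))).2.
  move=> Nn; apply: le_trans (top_ge hJ (lottery_simplex hJ nuP t_le1 _)).
  by rewrite lerD2l lerN2 ltW ?hN.
have conf k n : (N <= n)%N -> 1 / 2 < lottery (mkseq h n) k -> 1 - e <= lottery
    (mkseq h n) k.
  move=> Nn /(top_gt_half hJ (lottery_simplex hJ nuP t_le1 _)) {1}->;
    exact: top.
(* The leader at time N wins: holding at least 1 - e, it loses less than e in one transfer, keeps
   more than 1/2 because e < 1/4, hence still leads and again holds at least 1 - e. *)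
have [k hk] : exists k, winner k h.
  exists (top_two hJ (lottery (mkseq h N))).2; exists N => n Nn.
  set k := (_).2; suff : 1 - e <= lottery (mkseq h n) k by lra.
  rewrite -(subnK Nn); elim: (n - N)%N => [|m IH]; first exact: top.
  apply: conf; first exact: leq_addl.
  rewrite addSn mkseqS lottery_rcons.
  have sl := lottery_simplex hJ nuP t_le1 (mkseq h (m + N)).
  apply: lt_le_trans (transfer_ge hJ k sl (t_le1 _)).
  have : second hJ (lottery (mkseq h (m + N))) < e.
    apply: le_lt_trans (hN (m + N)%N (leq_addl _ _)).
    by rewrite ler_peMl ?second_ge0 // ler1n ltnW.
  lra.
have kj : k = j by rewrite -hj (outcome_winner hk).
case: hk => M hM; exists (maxn N M) => n; rewrite geq_max => /andP[Nn Mn].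
by apply: conf => //; rewrite -kj; exact: hM.
Qed.

(** Continuity from below: [F N] increases to the event and is contained in the event that B holds
    at time N. *)
Lemma prob_eventually_le (B : set (seq X)) (u : \bar R) :
  (forall n, P [set h | B (mkseq h n)] <= u)%E ->
  (P [set h | exists N, forall n, (N <= n)%N -> B (mkseq h n)] <= u)%E.
Proof.
move=> Bu; pose F N := [set h : Hoo | forall n, [set w | (N <= size w)%N -> B w]
  (mkseq h n)].
have mF N : measurable (F N) by exact: measurable_forall_prefix.
have -> : [set h | exists N, forall n, (N <= n)%N -> B (mkseq h n)] = \bigcup_N
    F N.
  apply/seteqP; split => h [N]; last move=> _.
    by move=> BN; exists N => // n /=; rewrite size_mkseq; exact: BN.
  by move=> BN; exists N => n Nn; have := BN n; rewrite /= size_mkseq; apply.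
have cF : (P \o F) x @[x --> \oo] --> P (\bigcup_n F n).
  apply: nondecreasing_cvg_mu => //; first exact: bigcupT_measurable.
  move=> N M NM; apply/subsetPset => h hN n /= Mn; apply: (hN n).
  exact: leq_trans Mn.
rewrite -(cvg_lim _ cF) //; apply: lime_le; first by apply/cvg_ex; eexists;
  exact: cF.
apply: nearW => N /=; apply: le_trans (Bu N).
apply: le_measure; rewrite ?inE //; first exact: measurable_prefix.
by move=> h hN; have := hN N; rewrite /= size_mkseq; apply.
Qed.

(* Up to a null event, [outcome h = j] forces [lottery (mkseq h n) j >= 1 - e]
   for large n; Markov's inequality bounds the latter at each fixed n. *)
Lemma prob_outcome_le j : (P [set h | outcome h = j] <= (nu j)%:E)%E.
Proof.
have mE : measurable [set h | outcome h = j] by exact: (measurable_outcome [set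
    j]).
have key (e : R) : 0 < e -> e < 1 / 4 ->
    (P [set h | outcome h = j] <= (nu j / (1 - e))%:E)%E.
  move=> e0 e1.
  pose S := lim_sup_set (fun n => [set h' : Hoo | e / #|J|%:R <= second hJ
    (lottery (mkseq h' n))]).
  have mS : measurable S.
    exact: (measurable_lim_sup_prefix [set w | e / #|J|%:R <= second hJ (lottery
      w)] id).
  have J0 : 0 < #|J|%:R :> R by rewrite ltr0n ltnW.
  pose T := [set h : Hoo | exists N, forall n, (N <= n)%N -> 1 - e <= lottery
    (mkseq h n) j].
  have mT : measurable T.
    exact: (measurable_eventually_prefix [set w | 1 - e <= lottery w j]).
  apply: (@le_trans _ _ (P (T `|` S))).
    apply: le_measure; rewrite ?inE //; first exact: measurableU.
    move=> h hj; have [hS|hS] := pselect (S h); [by right | left].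
    exact: outcome_settled e0 e1 hS hj.
  rewrite measureU0 //; last by apply: second_vanishes; exact: divr_gt0.
  apply: (prob_eventually_le (B := [set w | 1 - e <= lottery w j])) => n.
  rewrite (prob_prefix HP n (fun w => 1 - e <= lottery w j)) lee_fin.
  rewrite ler_pdivlMr; last lra.
  rewrite mulrC -later_meanZ.
  (* The martingale starts at [nu j], which is therefore also its mean after n stages. *)
  rewrite -[nu j]/(lottery [::] j).
  rewrite -(later_mean_harmonic (g := fun w => lottery w j) [::] n
    (next_mean_lottery ^~ j)).
  apply: later_mean_le => w; have [v0 _] := lottery_simplex hJ nuP t_le1 w.
  by case: (leP (1 - e) (lottery w j)) => [?|_] /=; rewrite ?mulr1 ?mulr0.
have fE : P [set h | outcome h = j] \is a fin_num by exact: fin_num_measure.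
rewrite -(fineK fE) in key *; set p := fine _ in key *.
have p1 : p <= 1 by rewrite -lee_fin fineK // probability_le1.
rewrite lee_fin leNgt; apply/negP => nup.
(* The bound 1/8 meets the constraint e < 1/4; the other one makes p e smaller than p - nu j,
   contradicting p (1 - e) <= nu j. *)
pose e := Num.min (1 / 8) ((p - nu j) / 2).
have e0 : 0 < e by rewrite lt_min; apply/andP; split; lra.
have e8 : e <= 1 / 8 by rewrite ge_min lexx.
have ep : e <= (p - nu j) / 2 by rewrite ge_min lexx orbT.
have := key e e0; rewrite lee_fin ler_pdivlMr; last lra.
move=> H; have {}H := H ltac:(lra); nra.
Qed.

End Outcome.

(** * The mechanism *)

Section Weights.
Set Implicit Arguments.
Unset Strict Implicit.
Unset Printing Implicit Defensive.
Variables (R : realType) (A : finType).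
Implicit Types d : dist R A.

(** Probability at most 1/2 is what keeps p / (1 - p) at most 1, hence the weights in [-1, 1]. *)
Lemma unlikely_letter d : (1 < #|A|)%N -> exists a, d a <= 1 / 2.
Proof.
move=> hA; pose a := enum_val (Ordinal (ltnW hA)); pose b := enum_val (Ordinal
  hA).
have ba : b != a by apply/eqP => /enum_val_inj.
have [da|da] := leP (d a) (1 / 2); [by exists a | exists b].
have := dist_sum1 d; rewrite (bigD1 a) //= (bigD1 b) //=.
have : 0 <= \sum_(i | (i != a) && (i != b)) d i by apply: sumr_ge0 => i _;
    exact: dist_ge0.
lra.
Qed.

Definition signed_weight (p : R) (a b : A) : R := if b == a then 1 else - (p /
  (1 - p)).

Lemma signed_weight_bounds p a b : 0 < p <= 1 / 2 ->
  p <= `|signed_weight p a b| <= 1.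
Proof.
move=> /andP[p0 p1]; rewrite /signed_weight; case: eqP => _.
  by rewrite normr1; lra.
rewrite normrN ger0_norm ?divr_ge0; [|lra..].
by rewrite ler_pdivlMr ?ler_pdivrMr; [nra|lra..].
Qed.

Lemma signed_weight_centered d a : d a < 1 ->
  \sum_b d b * signed_weight (d a) a b = 0.
Proof.
move=> da; rewrite (bigD1 a) //= /signed_weight eqxx mulr1.
under eq_bigr => b /negbTE -> do [].
have := dist_sum1 d; rewrite (bigD1 a) //= -mulr_suml.
set S := \sum_(b | _) _ => daS; have -> : S = 1 - d a by lra.
by rewrite mulrN mulrCA divff ?mulr1 ?subrr //; lra.
Qed.

End Weights.

(** * The stopping time: K-th occurrence of a given pair of letters *)

Section Meeting.
Local Open Scope classical_set_scope.
Set Implicit Arguments.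
Unset Strict Implicit.
Unset Printing Implicit Defensive.
Variables (A1 A2 : finType) (hA1 : (1 < #|A1|)%N) (hA2 : (1 < #|A2|)%N).
Local Notation X := (A1 * A2)%type.
Local Notation Hoo := (infhist hA1 hA2).
Variables (z : X) (K : nat).

Definition meeting_time (h : Hoo) : option nat :=
  if pselect (exists n, (K <= count_mem z (mkseq h n))%N) is left e
  then Some (ex_minn e) else None.

Lemma count_mkseq_le (A : pred X) (h : Hoo) m n : (m <= n)%N ->
  (count A (mkseq h m) <= count A (mkseq h n))%N.
Proof.
move=> /subnK <-; elim: (n - m)%N => [|k IH] //.
by rewrite addSn mkseqS -cats1 count_cat (leq_trans IH) ?leq_addr.
Qed.

Lemma meeting_time_le n :
  tau_le meeting_time n = [set h | (K <= count_mem z (mkseq h n))%N].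
Proof.
apply/seteqP; split => h; rewrite /tau_le /= /meeting_time;
  case: pselect => [e|ne] /=.
- case=> m [<-]; case: ex_minnP => k kK _ kn.
  exact: leq_trans kK (count_mkseq_le _ _ kn).
- by case.
- by move=> nK; exists (ex_minn e) => //; case: ex_minnP => k _; exact.
- by move=> nK; case: ne; exists n.
Qed.

Lemma meeting_time_infinite :
  tau_infinite meeting_time = [set h | forall n, (count_mem z (mkseq h n) <
    K)%N].
Proof.
apply/seteqP; split => h; rewrite /tau_infinite /= /meeting_time;
  case: pselect => [e|ne] //=.
  by move=> _ n; rewrite ltnNge; apply/negP => nK; apply: ne; exists n.
by case: e => n nK /(_ n); rewrite ltnNge nK.
Qed.

Lemma tau_finiteE (tau : Hoo -> option nat) : tau_finite tau = ~` tau_infinite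
    tau.
Proof.
apply/seteqP; split => h; rewrite /tau_finite /tau_infinite /=;
  first by case=> n ->.
by case: (tau h) => // n _; exists n.
Qed.

Lemma meeting_time_stopping : is_stopping_time meeting_time.
Proof.
move=> n; rewrite meeting_time_le.
exact: (@hist_filtration_prefix _ _ _ _ n [set w | (K <= count_mem z w)%N]).
Qed.

End Meeting.

Section LotteryMechanism.
Local Open Scope classical_set_scope.
Set Implicit Arguments.
Unset Strict Implicit.
Unset Printing Implicit Defensive.
Variables (A1 A2 : finType) (hA1 : (1 < #|A1|)%N) (hA2 : (1 < #|A2|)%N).
Local Notation X := (A1 * A2)%type.
Local Notation Hoo := (infhist hA1 hA2).
Variables (R : realType) (J : finType) (hJ : (1 < #|J|)%N).
Variables (t : X -> R) (z : X) (nu : J -> R).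
Hypotheses (nuP : simplex nu) (t_le1 : forall x, `|t x| <= 1) (tz : t z = 1).

Let tau : Hoo -> option nat := meeting_time z #|J|.
Let f : Hoo -> J := outcome hJ t nu.

(** By then the walk sits at a vertex and no longer moves, so the outcome can be read off the
    prefix; this makes it measurable at the stopping time. *)
Lemma outcome_stopped n (h : Hoo) : (#|J| <= count_mem z (mkseq h n))%N ->
  f h = (top_two hJ (lottery hJ t nu (mkseq h n))).2.
Proof.
move=> nJ; have s0 := lottery_degenerate hJ nuP t_le1 tz nJ.
apply: outcome_winner => //; exists n => m /subnK <-.
have -> : lottery hJ t nu (mkseq h (m - n + n)) = lottery hJ t nu (mkseq h n).
  elim: (m - n)%N => [|k IH] //.
  by rewrite addSn mkseqS lottery_rcons IH transfer0.
have := top_ge hJ (lottery_simplex hJ nuP t_le1 (mkseq h n)).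
by rewrite s0; lra.
Qed.

Lemma outcome_stopped_sigma_algebra (B : set J) :
  stopped_sigma_algebra tau (f @^-1` B).
Proof.
split=> [|n]; first exact: measurable_outcome.
rewrite meeting_time_le (_ : _ `&` _ = [set h | [set w | (#|J| <= count_mem z
  w)%N /\
    B (top_two hJ (lottery hJ t nu w)).2] (mkseq h n)]).
  exact: hist_filtration_prefix.
apply/seteqP; split => h /= [].
  by move=> Bh nJ; split => //; rewrite -(outcome_stopped nJ).
by move=> nJ Bh; split => //; rewrite -(outcome_stopped nJ) in Bh.
Qed.

Definition lottery_mechanism : mechanism hA1 hA2 J :=
  Mechanism (meeting_time_stopping z #|J|) outcome_stopped_sigma_algebra.

End LotteryMechanism.

(** * Equality of laws and complements of null events *)

Section Laws.
Local Open Scope classical_set_scope.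
Set Implicit Arguments.
Unset Strict Implicit.
Unset Printing Implicit Defensive.
Variables (A1 A2 : finType) (hA1 : (1 < #|A1|)%N) (hA2 : (1 < #|A2|)%N).
Local Notation Hoo := (infhist hA1 hA2).
Variables (R : realType) (J : finType) (M : mechanism hA1 hA2 J).
Variable mu : probability Hoo R.

Lemma sum_outcome_law : \sum_j outcome_law mu M j = 1.
Proof.
have mf j : measurable [set h | mech_out M h = j].
  by have [] := mech_outP M [set j].
have : mu (\bigcup_j [set h | mech_out M h = j]) = 1%E.
  rewrite (_ : \bigcup_j _ = setT) ?probability_setT //.
  by apply/seteqP; split => // h _; exists (mech_out M h).
rewrite measure_fin_bigcup //; last 2 first.
- exact: finite_finset.
- by move=> i j _ _ [h [/= -> ->]].
have -> : [set: J] = [set` enum J] by apply/seteqP; split => x //= _;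
    rewrite mem_enum.
rewrite -fsbig_seq ?enum_uniq // big_enum /=.
rewrite (eq_bigr (fun j => (outcome_law mu M j)%:E)) => [|j _]; last first.
  by rewrite fineK // fin_num_measure.
by rewrite sumEFin => -[].
Qed.

(** Both laws have total mass 1, so the one-sided bounds already give exact implementation. *)
Lemma outcome_law_eq (nu : dist R J) :
  (forall j, outcome_law mu M j <= nu j) -> forall j, outcome_law mu M j = nu j.
Proof.
move=> le_nu j; have : \sum_j (nu j - outcome_law mu M j) = 0.
  by rewrite sumrB dist_sum1 sum_outcome_law subrr.
move/psumr_eq0P => /(_ _ j isT) H; apply/esym/eqP; rewrite -subr_eq0;
  apply/eqP/H => i _.
by rewrite subr_ge0.
Qed.

End Laws.

Local Open Scope classical_set_scope.

Lemma prob_add_compl_null (d : measure_display) (T : measurableType d) (R :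
    realType) (P : probability T R)
    (D F N : set T) : measurable D -> measurable F -> measurable N ->
  D `&` F = set0 -> D `|` F = ~` N -> P N = 0%E -> (P D + P F)%E = 1%E.
Proof.
move=> mD mF mN DF0 DFN N0.
by have := probability_setC P mN; rewrite N0 sube0 -DFN measureU.
Qed.

Local Close Scope classical_set_scope.

Theorem theorem2p6 (R : realType) (A1 A2 J : finType)
    (hA1 : (1 < #|A1|)%N) (hA2 : (1 < #|A2|)%N) (hJ : (1 < #|J|)%N)
    (s1 : strategy R A1 A2 A1) (s2 : strategy R A1 A2 A2)
    (stat1 : stationary s1) (stat2 : stationary s2)
    (pos1 : forall w a, 0 < s1 w a) (pos2 : forall w a, 0 < s2 w a)
    (nu : dist R J) :
  exists M : mechanism hA1 hA2 J, weak_secure_implements 0 M s1 s2 nu.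
Proof.
have [x px] := unlikely_letter (s1 [::]) hA1.
have [y qy] := unlikely_letter (s2 [::]) hA2.
pose p := s1 [::] x; pose q := s2 [::] y.
have p0 : 0 < p := pos1 _ _; have q0 : 0 < q := pos2 _ _.
have s1x w : s1 w x = p := stat1 _ _ _; have s2y w : s2 w y = q := stat2 _ _ _.
pose t (z : A1 * A2) : R := signed_weight p x z.1 * signed_weight q y z.2.
have bnd1 a : p <= `|signed_weight p x a| <= 1.
  by apply: signed_weight_bounds; rewrite p0.
have bnd2 a : q <= `|signed_weight q y a| <= 1.
  by apply: signed_weight_bounds; rewrite q0.
have t_le1 z : `|t z| <= 1.
  by have /andP[_ ?] := bnd1 z.1; have /andP[_ ?] := bnd2 z.2;
    rewrite normrM mulr_ile1.
have t_ge z : p * q <= `|t z|.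
  by have /andP[? _] := bnd1 z.1; have /andP[? _] := bnd2 z.2;
    rewrite normrM ler_pM // ltW.
have t1 : t (x, y) = 1 by rewrite /t /signed_weight !eqxx mulr1.
have nuP : simplex nu by split; [exact: dist_ge0 | exact: dist_sum1].
have pq0 : 0 < p * q by rewrite mulr_gt0.
have cent1 w : \sum_a s1 w a * signed_weight p x a = 0.
  rewrite -(s1x w); apply: signed_weight_centered.
  by rewrite s1x /p; lra.
have cent2 w : \sum_b s2 w b * signed_weight q y b = 0.
  rewrite -(s2y w); apply: signed_weight_centered.
  by rewrite s2y /q; lra.
(* Independence of the two choices factors the mean of t, and the honest player's factor is zero. *)
have splitE (r1 : strategy R A1 A2 A1) (r2 : strategy R A1 A2 A2) w :
    \sum_z r1 w z.1 * r2 w z.2 * t z =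
    (\sum_a r1 w a * signed_weight p x a) * (\sum_b r2 w b * signed_weight q y
      b).
  rewrite big_distrlr pair_big /=; apply: eq_bigr => -[a b] _ /=.
  by rewrite /t /= mulrACA.
have centered1 (r1 : strategy R A1 A2 A1) w : \sum_z r1 w z.1 * s2 w z.2 * t z =
    0.
  by rewrite (splitE r1 s2) cent2 mulr0.
have centered2 (r2 : strategy R A1 A2 A2) w : \sum_z s1 w z.1 * r2 w z.2 * t z =
    0.
  by rewrite (splitE s1 r2) cent1 mul0r.
pose M := lottery_mechanism hA1 hA2 hJ nuP t_le1 t1.
pose P := @play_prob R A1 A2 hA1 hA2.
have PP r1 r2 : induced_by_play r1 r2 (P r1 r2) := play_probP hA1 hA2 r1 r2.
have law_le (r1 : strategy R A1 A2 A1) (r2 : strategy R A1 A2 A2) : (forall w,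
    \sum_z r1 w z.1 * r2 w z.2 * t z = 0) ->
    forall j, outcome_law (P r1 r2) M j <= nu j.
  move=> cent j; have := prob_outcome_le hJ nuP t_le1 pq0 t_ge cent (PP r1 r2)
    j.
  rewrite /outcome_law /= => H.
  by rewrite -lee_fin fineK // fin_num_measure //; exact: (measurable_outcome hJ
    nuP t_le1 [set j]%classic).
exists M; split.
- rewrite /implements /sup_norm; apply/bigmax_leP; split=> // j _.
  by rewrite /play_outcome (outcome_law_eq (law_le _ _ (centered1 s1))) subrr
    normr0.
- by move=> r1; exact: law_le.
- by move=> r2; exact: law_le.
pose rare : set (infhist hA1 hA2) :=
  [set h | exists N, forall n, (count (fun z => z.2 == y) (mkseq h n) <
    N)%N]%classic.
have m_inf : measurable (tau_infinite (mech_time M)).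
  rewrite meeting_time_infinite.
  exact: (measurable_forall_prefix [set w | (count_mem (x, y) w <
    #|J|)%N]%classic).
have m_fin : measurable (tau_finite (mech_time M)).
  by rewrite tau_finiteE; exact: measurableC.
have m_rare : measurable rare by exact: measurable_bounded_visits.
pose D1 := (tau_infinite (mech_time M) `&` ~` rare)%classic.
pose D2 := (tau_infinite (mech_time M) `&` rare)%classic.
have mD1 : measurable D1 by apply: measurableI => //; exact: measurableC.
have mD2 : measurable D2 by apply: measurableI.
(* Each detection event is null as soon as the other player is the only possible deviator. Under a
   deviation of player 1, [D2] is thus null, so [D1] and stopping share the whole mass;
   symmetrically for player 2. *)
have D1_null r2 : P s1 r2 D1 = 0%E.
  rewrite /D1 meeting_time_infinite.
  exact: (rare_meeting_null (PP s1 r2) y #|J| p0 s1x).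
have D2_null r1 : P r1 s2 D2 = 0%E.
  apply: subset_measure0 (bounded_visits_null (PP r1 s2) q0 s2y) => //.
  by move=> h [].
exists D1, D2; split.
- by split=> //; apply/seteqP; split => h // [[_ ?] [_ ?]].
- by move=> h [[]|[]].
- by split; [exact: D1_null | exact: D2_null].
- move=> r1; apply: (@prob_add_compl_null _ _ _ (P r1 s2) _ _ D2) => //.
    by rewrite tau_finiteE; apply/seteqP; split => h // [[] ].
  rewrite tau_finiteE; apply/seteqP; split => h /=.
    by move=> [[_ nr]|ni] [].
  move=> nD; have [hi|] := pselect (tau_infinite (mech_time M) h);
    last by right.
  by left; split => // hr; apply: nD.
- move=> r2; apply: (@prob_add_compl_null _ _ _ (P s1 r2) _ _ D1) => //.
    by rewrite tau_finiteE; apply/seteqP; split => h // [[] ].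
  rewrite tau_finiteE; apply/seteqP; split => h /=.
    by move=> [[_ hr]|ni] [].
  move=> nD; have [hi|] := pselect (tau_infinite (mech_time M) h);
    last by right.
  by left; split => //; apply: contrapT => hr; apply: nD.
Qed.
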